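(* There exist a constant $c>0$ and, for infinitely many $n$, an $n$-vertex planar $3$-tree $G$ with a designated outer triangle such that every planar straight-line drawing of $G$ with that outer face has vertex-ply at least $cn$ (and hence ply at least $cn$; in particular vertex-ply and ply $\Theta(n)$), while $G$ admits a straight-line drawing with ply $5$, vertex-ply $4$, and three edge crossings.
   Context: A planar $3$-tree is a graph obtained from a $3$-cycle by repeatedly adding a new vertex inside a triangular face and connecting it to the three vertices of that face. A straight-line drawing of a graph places each vertex at a distinct point of the plane and draws each edge as the straight-line segment between its endpoints; it is planar if no two edges cross. For each vertex $v$, the ply-disk $D_v$ is the open disk centered at $v$ with radius equal to half the length of the longest edge incident to $v$. The ply of a drawing is the maximum, over all points $p$ of the plane, of the number of ply-disks containing $p$ in their interior. The vertex-ply is the same maximum taken only over points $p$ at which vertices are placed. *)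

(* Defs.v *)
From mathcomp Require Import all_boot all_order all_algebra.
From mathcomp Require Import all_classical all_reals all_analysis.
Import Order.TTheory GRing.Theory Num.Theory.
Import numFieldNormedType.Exports.

Set Implicit Arguments.
Unset Strict Implicit.
Unset Printing Implicit Defensive.

Local Open Scope ring_scope.

(* A graph on V is given by its edge set E, whose elements are two-element
   sets of vertices. *)

Definition triangle_edges (V : finType) (t : {set V}) : {set {set V}} :=
  [set e : {set V} | (e \subset t) && (#|e| == 2%N)]%SET.

(* [planar_3tree U E F]: U is the vertex set, E the edge set and F the list of
   faces, each face being identified with its set of three vertices.  A 3-cycle
   in the plane has two faces (its inside and its outside), hence the
   repetition in the base case.  The designated outer triangle of a planar
   3-tree may be any of the faces in F; a triangle that is not a face cannot
   bound the outer face of a planar drawing. *)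
Inductive planar_3tree (V : finType) :
    {set V} -> {set {set V}} -> seq {set V} -> Prop :=
| planar_3tree_cycle (t : {set V}) of #|t| = 3%N :
    planar_3tree t (triangle_edges t) [:: t; t]
| planar_3tree_insert (U : {set V}) (E : {set {set V}}) (F : seq {set V})
    (f : {set V}) (v : V) of planar_3tree U E F & f \in F & v \notin U :
    planar_3tree (v |: U)%SET
      (E :|: [set [set v; x] | x in f])%SET
      ([seq (v |: (f :\ x))%SET | x <- enum f] ++ rem f F).

(* The topology and bornology of the plane are those of the product R * R, but
   its norm is the sup norm, so the Euclidean distance is defined here. *)
Definition edist (R : realType) (p q : R * R) : R :=
  Num.sqrt ((p.1 - q.1) ^+ 2 + (p.2 - q.2) ^+ 2).

Definition segment (R : realType) (p q : R * R) : set (R * R) :=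
  [set x | exists2 t : R, 0 <= t <= 1 &
     x = ((1 - t) * p.1 + t * q.1, (1 - t) * p.2 + t * q.2)]%classic.

Definition edge_segment (R : realType) (V : finType) (pos : V -> R * R)
    (e : {set V}) : set (R * R) :=
  [set x | exists u v : V, e = [set u; v]%SET /\ segment (pos u) (pos v) x]%classic.

(* The second condition is the usual convention that an edge does not pass
   through a vertex other than its ends.  It is automatic for the planar
   drawings of a graph without isolated vertices. *)
Definition straight_line_drawing (R : realType) (V : finType)
    (E : {set {set V}}) (pos : V -> R * R) : Prop :=
  injective pos /\
  (forall (e : {set V}) (v : V),
     e \in E -> v \notin e -> ~ edge_segment pos e (pos v)).

(* Two distinct edges cross if they share a point other than a common end. *)
Definition cross (R : realType) (V : finType) (pos : V -> R * R)
    (e f : {set V}) : Prop :=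
  e <> f /\
  exists x : R * R, [/\ edge_segment pos e x, edge_segment pos f x &
    forall v : V, v \in e -> v \in f -> x <> pos v].

Definition planar_drawing (R : realType) (V : finType)
    (E : {set {set V}}) (pos : V -> R * R) : Prop :=
  straight_line_drawing E pos /\
  (forall e f : {set V}, e \in E -> f \in E -> ~ cross pos e f).

(* Crossings are counted as unordered pairs of crossing edges. *)
Definition num_crossings (R : realType) (V : finType)
    (E : {set {set V}}) (pos : V -> R * R) : nat :=
  #|[set P : {set {set V}} |
      `[< exists e f : {set V},
            [/\ e \in E, f \in E, cross pos e f & P = [set e; f]%SET] >]]%SET|.

Definition drawn_points (R : realType) (V : finType)
    (E : {set {set V}}) (pos : V -> R * R) : set (R * R) :=
  [set x | (exists v : V, x = pos v) \/
           (exists2 e : {set V}, e \in E & edge_segment pos e x)]%classic.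

(* The faces are the connected components of the complement of the drawing;
   exactly one of them is unbounded. *)
Definition outer_face (R : realType) (V : finType)
    (E : {set {set V}}) (pos : V -> R * R) : set (R * R) :=
  [set x | (~` drawn_points E pos) x /\
           ~ bounded_set (connected_component (~` drawn_points E pos) x)]%classic.

Definition boundary (R : realType) (A : set (R * R)) : set (R * R) :=
  (closure A `\` interior A)%classic.

Definition has_outer_triangle (R : realType) (V : finType)
    (E : {set {set V}}) (pos : V -> R * R) (t : {set V}) : Prop :=
  boundary (outer_face E pos) =
  [set x | exists2 e : {set V}, e \in triangle_edges t &
           edge_segment pos e x]%classic.

Definition ply_radius (R : realType) (V : finType)
    (E : {set {set V}}) (pos : V -> R * R) (v : V) : R :=
  (\big[Num.max/0]_(u : V | [set v; u]%SET \in E) edist (pos v) (pos u)) / 2.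

Definition ply_disk (R : realType) (V : finType)
    (E : {set {set V}}) (pos : V -> R * R) (v : V) : set (R * R) :=
  [set x | edist (pos v) x < ply_radius E pos v]%classic.

Definition ply_at (R : realType) (V : finType)
    (E : {set {set V}}) (pos : V -> R * R) (x : R * R) : nat :=
  #|[set v : V | x \in ply_disk E pos v]%SET|.

(* The maximum over the whole plane, taken over the finitely many values
   k <= #|V| that [ply_at] may attain. *)
Definition ply (R : realType) (V : finType)
    (E : {set {set V}}) (pos : V -> R * R) : nat :=
  \max_(k < #|V|.+1 | `[< exists x : R * R, ply_at E pos x = k >]) k.

Definition vertex_ply (R : realType) (V : finType)
    (E : {set {set V}}) (pos : V -> R * R) : nat :=
  \max_(v : V) ply_at E pos (pos v).

(* Main.v *)
Require Import Defs.
From HB Require Import structures.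
From mathcomp Require Import all_boot all_order all_algebra.
From mathcomp Require Import all_classical all_reals all_analysis.
From mathcomp Require Import zify lra ring.
Import Order.TTheory GRing.Theory Num.Theory.
Import numFieldNormedType.Exports.

Set Implicit Arguments.
Unset Strict Implicit.
Unset Printing Implicit Defensive.

Local Open Scope ring_scope.

(* Let a, b, c be the outer triangle, d a vertex inside it and z a vertex in the
   face acd.  Insert a chain u_0, u_1, ... with u_i adjacent to a, b and u_(i-1),
   and a chain w_0, w_1, ... with w_i adjacent to c, b and w_(i-1), both chains
   starting from u_(-1) = w_(-1) = d.

   In a drawing with outer triangle abc every vertex lies in the bounding box of
   a, b, c: beyond the extreme vertex in any direction the plane is empty and
   unbounded, so that vertex is on the boundary of the outer face.  If M is the
   larger of |ab| and |bc|, this box lies in a square of side 2M around b, while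
   each vertex of the chain over the longer side has a neighbour at distance at
   least M/2, hence a ply-disk of radius at least M/4.  Cutting the square into
   17 x 17 cells of side M/8, the ply-disks of chain vertices in one cell contain
   all of these vertices, and some cell contains k/289 of them.

   Letting the chains leave the triangle removes this obstruction: with
   a = (1, 1), b = (0, -1), c = (-1, 1), d = (0, 0), z = (0, 2),
   u_i = (2^(i+2) - 2, 0) and w_i = - u_i, the ply-disk of u_i has radius at most
   2^(i+1) and does not reach u_(i-1), and only consecutive disks of a chain
   overlap.  The crossings are d u_0 with ab, d w_0 with bc, and d z with ac. *)

(** * The vertices in order of insertion *)

(* [Va true], [Vb], [Va false] are a, b, c; [Vu true i] is u_i and [Vu false i]
   is w_i. *)
Inductive vert : Type :=
  Va of bool | Vb | Vd | Vz | Vu of bool & nat.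

(** The insertion order. The chains alternate, w_i just before u_i, so the labels below [2k + 5] are
    those of a, b, c, d, z and the first k vertices of each chain. *)
Definition label (v : vert) : nat :=
  match v with
  | Va true => 0 | Vb => 1 | Va false => 2 | Vd => 3 | Vz => 4
  | Vu s i => (s + i.*2).+4.+1
  end.

Definition unlabel (m : nat) : vert :=
  match m with
  | 0 => Va true | 1 => Vb | 2 => Va false | 3 => Vd | 4 => Vz
  | m'.+4.+1 => Vu (odd m') m'./2
  end.

Lemma labelK : cancel label unlabel.
Proof.
case=> [[]||||s i] //=; rewrite oddD odd_double addbF.
by rewrite half_bit_double; case: s.
Qed.

Lemma unlabelK : cancel unlabel label.
Proof.
case=> [|[|[|[|[|m]]]]] //=.
by rewrite odd_double_half.
Qed.

HB.instance Definition _ := Equality.copy vert (can_type labelK).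

Definition prev (s : bool) (i : nat) : vert :=
  if i is j.+1 then Vu s j else Vd.

(** The neighbours inserted earlier; from d on, the corners of the face that receives the vertex. *)
Definition parents (v : vert) : seq vert :=
  match v with
  | Va true => [::]
  | Vb => [:: Va true]
  | Va false => [:: Va true; Vb]
  | Vd => [:: Va true; Vb; Va false]
  | Vz => [:: Va true; Va false; Vd]
  | Vu s i => [:: Va s; Vb; prev s i]
  end.

Lemma Vu_eq s i s' i' : (Vu s i == Vu s' i') = (s == s') && (i == i').
Proof. by apply/eqP/andP => [[-> ->]|[/eqP-> /eqP->]]. Qed.

Lemma Va_eq s s' : (Va s == Va s') = (s == s').
Proof. by apply/eqP/eqP => [[->]|->]. Qed.

Lemma label_parents v x : x \in parents v -> (label x < label v)%N.
Proof.
case: v => [[]||||s [|i]]; rewrite /= ?inE //.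
- by case/orP=> /eqP->.
- by move/eqP->.
- by case/or3P=> /eqP->.
- by case/or3P=> /eqP->.
- by case/or3P=> /eqP-> //; case: s.
- by case/or3P=> /eqP-> //; case: s => //=; lia.
Qed.

(** A later neighbour w of u goes into one of the three faces created by u. The corner [x] that u
    replaces is b for z, the far one of a and c for u_0 and w_0, and the predecessor of u further
    along a chain. *)
Lemma parents_last u w : u \in parents w -> (3 <= label u)%N ->
  exists2 x, x \in parents u &
    parents w =i [pred y | (y == u) || (y \in parents u) && (y != x)].
Proof.
case: w => [[]||||s [|i]]; rewrite /= ?inE //.
- by case/orP=> /eqP->.
- by move/eqP->.
- by case/or3P=> /eqP->.
- case/or3P=> /eqP-> // _; exists Vb; first by rewrite !inE.
  by move=> [[]||||[] j]; rewrite !inE.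
- case/or3P=> /eqP->; rewrite ?(fun_if label) //=; first by case: s.
  move=> _; exists (Va (~~ s)); first by case: s.
  by move=> [[]||||[] j]; case: s; rewrite !inE.
- case/or3P=> /eqP->; rewrite //=; first by case: s.
  move=> _; exists (prev s i); first by rewrite !inE eqxx !orbT.
  move=> y; rewrite !inE.
  have [->|yp] := eqVneq y (prev s i).
    by rewrite andbF orbF; case: i => [|i]; case: s.
  by case: (y == Va s); case: (y == Vb); case: (y == Vu s i).
Qed.

(** Guarantees that inserting u does not use up the face reserved for a later w not adjacent to
    u. *)
Lemma parents_inj u w : (3 <= label u)%N -> (3 <= label w)%N ->
  u \notin parents w -> {subset parents w <= parents u} -> w = u.
Proof.
move=> lu lw uw sub.
have {}sub y : y \in parents w -> y \in parents u by apply: sub.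
case: w lw uw sub => [[]||||s [|i]] //= _ uw sub.
- case: u lu uw sub => [[]||||s' i] //= _ _ sub.
    by have := sub Vb; rewrite !inE => /(_ isT).
  by have := sub (Va (~~ s')); case: s' {sub}; case: i => [|i]; rewrite !inE /= => /(_ isT).
- case: u lu uw sub => [[]||||s' i] //= _ _ sub.
  by have := sub (Va (~~ s')); case: s' {sub}; case: i => [|i]; rewrite !inE /= => /(_ isT).
- case: u lu uw sub => [[]||||s' [|i]] //= _ uw sub.
  + by move: uw; rewrite !inE eqxx !orbT.
  + by have := sub Vb; rewrite !inE eqxx orbT => /(_ isT).
  + have := sub (Va s); rewrite !inE !Va_eq eqxx.
    by case: s {sub uw}; case: s' => //= /(_ isT).
  + by have := sub Vd; rewrite !inE eqxx !orbT => /(_ isT); case: s' {sub uw}.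
- move: (sub (Vu s i)); rewrite !inE eqxx !orbT => /(_ isT).
  case: u lu uw {sub} => [[]||||s' [|j]] //= _; rewrite !inE //; try by case: s'.
  by move=> _; rewrite Vu_eq; case/or3P => [/eqP//|/eqP//|/andP[/eqP-> /eqP->]].
Qed.

Lemma mem_rem_neq (T : eqType) (s : seq T) (x y : T) :
  y \in s -> y != x -> y \in rem x s.
Proof.
elim: s => //= z s IH; rewrite inE => /orP[/eqP<-|ys] yx.
  by rewrite (negPf yx) inE eqxx.
by case: eqP => // _; rewrite inE IH // orbT.
Qed.

(** * The graph is a planar 3-tree *)

Section Graph.
Variable k : nat.

Notation n := (k.*2).+4.+1.

Definition vert_of (i : 'I_n) : vert := unlabel i.
(** [inord] falls back on 0 outside its range, whence the bounds on labels carried by later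
    lemmas. *)
Definition ord_of (v : vert) : 'I_n := inord (label v).

Lemma vert_of_inj : injective vert_of.
Proof. by move=> i j /(can_inj unlabelK)/val_inj. Qed.

Lemma vert_ofK : cancel vert_of ord_of.
Proof. by move=> i; rewrite /ord_of /vert_of unlabelK inord_val. Qed.

Lemma ord_ofK v : (label v < n)%N -> vert_of (ord_of v) = v.
Proof. by move=> lv; rewrite /vert_of /ord_of inordK // labelK. Qed.

Lemma label_vert_of i : label (vert_of i) = i.
Proof. exact: unlabelK. Qed.

Lemma label_parents_vert_of (i : 'I_n) v : v \in parents (vert_of i) -> (label v < n)%N.
Proof. by move/label_parents; rewrite label_vert_of => /ltn_trans; apply. Qed.

Definition edges_below (m : nat) : {set {set 'I_n}} :=
  [set e | [exists v : 'I_n, exists x : 'I_n,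
     [&& (v < m)%N, vert_of x \in parents (vert_of v) & e == [set v; x]%SET]]]%SET.

Definition edges : {set {set 'I_n}} := edges_below n.

Definition face_of (v : vert) : {set 'I_n} :=
  [set x : 'I_n | vert_of x \in parents v]%SET.

(** The triangle abc, which as a set of corners is also the face that receives d. *)
Definition outer : {set 'I_n} := face_of Vd.

Lemma edges_belowP m (e : {set 'I_n}) :
  reflect (exists v x : 'I_n, [/\ (v < m)%N, vert_of x \in parents (vert_of v)
                                & e = [set v; x]%SET])
          (e \in edges_below m).
Proof.
rewrite inE; apply: (iffP existsP) => [[v /existsP[x /and3P[vm xv /eqP->]]]|].
  by exists v, x.
by case=> v [x [vm xv ->]]; exists v; apply/existsP; exists x; apply/and3P.
Qed.

Lemma edgesP (e : {set 'I_n}) :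
  reflect (exists v x : 'I_n, vert_of x \in parents (vert_of v) /\ e = [set v; x]%SET)
          (e \in edges).
Proof.
apply: (iffP (edges_belowP _ _)) => -[v [x]]; first by case=> _ ? ?; exists v, x.
by case=> ? ?; exists v, x.
Qed.

Lemma mem_outer (i : 'I_n) : (i \in outer) = (i < 3)%N.
Proof.
rewrite inE -(label_vert_of i); case: (vert_of i) => [[]||||s j]; rewrite !inE //.
Qed.

Lemma parents_small (v x : 'I_n) : (v < 3)%N ->
  (vert_of x \in parents (vert_of v)) = (x < v)%N.
Proof.
rewrite -(label_vert_of v) -(label_vert_of x).
by case: (vert_of v) => [[]||||s j] //= _; case: (vert_of x) => [[]||||s' j']; rewrite !inE.
Qed.

Lemma card_outer : #|outer| = 3%N.
Proof.
have -> : outer = [set inord 0; inord 1; inord 2]%SET.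
  apply/setP=> i; rewrite mem_outer !inE -!val_eqE /= !inordK //.
  by case: (val i) => [|[|[|j]]].
rewrite -finset.setUA cardsU1 cards2 !inE -!val_eqE /= !inordK //.
Qed.

Lemma triangle_edges_outer : triangle_edges outer = edges_below 3.
Proof.
apply/setP=> e; rewrite inE; apply/andP/edges_belowP => [[sub /cards2P[x [y [xy ee]]]]|].
  have xo : (x < 3)%N by rewrite -mem_outer (fintype.subsetP sub) // ee !inE eqxx.
  have yo : (y < 3)%N by rewrite -mem_outer (fintype.subsetP sub) // ee !inE eqxx orbT.
  move: xy; rewrite -val_eqE neq_ltn => /orP[lt|lt].
    by exists y, x; rewrite parents_small // ee finset.setUC.
  by exists x, y; rewrite parents_small.
move=> [v [x [v3 xv ->]]]; rewrite parents_small // in xv.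
split; last by rewrite cards2 -val_eqE neq_ltn xv orbT.
apply/fintype.subsetP=> i; rewrite in_set2 mem_outer => /orP[]/eqP->//.
exact: ltn_trans v3.
Qed.

Lemma face_of_outer v : (4 <= label v)%N -> (label v <= n)%N -> face_of v != outer.
Proof.
move=> l4 ln; apply/eqP=> /setP eqf.
have [x xv lx] : exists2 x, x \in parents v & (3 <= label x)%N.
  case: v l4 {ln eqf} => [[]||||s [|i]] //= _.
  - by exists Vd; rewrite ?inE ?eqxx ?orbT.
  - by exists Vd; rewrite ?inE ?eqxx ?orbT.
  - by exists (Vu s i); rewrite ?inE ?eqxx ?orbT.
have lxn := leq_trans (label_parents xv) ln.
have := eqf (ord_of x); rewrite mem_outer inE ord_ofK // xv /= inordK //.
by rewrite ltnNge lx.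
Qed.

(** The invariant of the insertions: a copy of the outer triangle is left once the face for the next
    vertex is taken out, and the face reserved for any vertex still to come is present as soon as
    its corners are. *)
Lemma planar_3tree_below m : (3 <= m)%N -> (m <= n)%N ->
  exists F : seq {set 'I_n},
  [/\ planar_3tree [set i : 'I_n | (i < m)%N]%SET (edges_below m) F,
      outer \in rem (face_of (unlabel m)) F
    & forall w, (m <= label w)%N -> (label w <= n)%N ->
        (forall x, x \in parents w -> (label x < m)%N) -> face_of w \in F].
Proof.
elim: m => // m IH; rewrite leq_eqVlt eqSS => /orP[/eqP<-|m3] mn.
  (* Both sides of the initial cycle are listed: d takes one copy and the other stays outer. *)
  exists [:: outer; outer]; split.
  - rewrite -triangle_edges_outer; have -> : [set i : 'I_n | (i < 3)%N]%SET = outer.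
      by apply/setP=> i; rewrite mem_outer inE.
    by constructor; exact: card_outer.
  - by rewrite /= -/outer eqxx inE.
  - move=> [[]||||s [|i]] //= _ _ /(_ _); first by rewrite inE eqxx.
    + by move/(_ Vd); rewrite !inE => /(_ isT).
    + by move/(_ Vd); rewrite !inE eqxx !orbT => /(_ isT).
    + by move/(_ (Vu s i)); rewrite !inE eqxx !orbT => /(_ isT).
case: (IH m3 (ltnW mn)) => F [tree out act].
pose v : 'I_n := Ordinal mn.
have vtv : vert_of v = unlabel m by [].
have fF : face_of (vert_of v) \in F.
  apply: act; [by rewrite label_vert_of | by rewrite label_vert_of; exact: ltnW |].
  by move=> x /label_parents; rewrite label_vert_of.
have lv : label (vert_of v) = m by rewrite label_vert_of.
set F' := [seq (v |: (face_of (vert_of v) :\ x))%SET | x <- enum (face_of (vert_of v))]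
   ++ rem (face_of (vert_of v)) F.
exists F'; split.
- have -> : [set i : 'I_n | (i < m.+1)%N]%SET = (v |: [set i : 'I_n | (i < m)%N])%SET.
    by apply/setP=> i; rewrite !inE ltnS leq_eqVlt -val_eqE.
  have -> : edges_below m.+1 =
      (edges_below m :|: [set [set v; x] | x in face_of (vert_of v)])%SET.
    apply/setP=> e; rewrite finset.in_setU; apply/edges_belowP/orP.
      move=> [w [x [wm xw ee]]]; move: wm; rewrite ltnS leq_eqVlt => /orP[/eqP wm|wm].
        right; apply/imsetP; have wv : w = v by apply: val_inj.
        by exists x; rewrite -wv // inE.
      by left; apply/edges_belowP; exists w, x.
    case=> [/edges_belowP[w [x [wm xw ee]]]|/imsetP[x]].
      by exists w, x; split=> //; apply: ltnW.
    by rewrite inE => xv ->; exists v, x; split=> /=.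
  by apply: planar_3tree_insert => //; rewrite inE ltnn.
- have oF' : outer \in F' by rewrite mem_cat out orbT.
  have ne : outer != face_of (unlabel m.+1).
    by rewrite eq_sym face_of_outer // unlabelK.
  exact: mem_rem_neq.
move=> w wm wn par; rewrite mem_cat.
have lw3 : (3 <= label w)%N by apply: leq_trans wm; apply: leqW.
have lv3 : (3 <= label (vert_of v))%N by rewrite lv.
(* Either the face of w has v as a corner and was just created, or it was there before and v went
   into a different face. *)
case: (boolP (vert_of v \in parents w)) => vw.
  have [x xv eqw] := parents_last vw lv3.
  apply/orP; left; apply/mapP; exists (ord_of x).
    by rewrite mem_enum inE ord_ofK // (label_parents_vert_of xv).
  apply/setP=> y; rewrite !inE eqw !inE.
  rewrite (inj_eq vert_of_inj) andbC; congr (_ || (_ && _)).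
  by rewrite -(inj_eq vert_of_inj) ord_ofK // (label_parents_vert_of xv).
have neq : face_of w != face_of (vert_of v).
  apply/eqP=> /setP eqf; have : w = vert_of v.
    apply: parents_inj => // y yw.
    have ly : (label y < n)%N by apply: leq_trans (label_parents yw) wn.
    by have := eqf (ord_of y); rewrite !inE !ord_ofK // yw => <-.
  by move=> wv; rewrite wv lv ltnn in wm.
have wF : face_of w \in F.
  apply: act => //; first exact: ltnW.
  move=> x xw; have := par x xw; rewrite ltnS leq_eqVlt => /orP[/eqP lx|//].
  by case/negP: vw; rewrite vtv -lx labelK.
by rewrite (mem_rem_neq wF neq) orbT.
Qed.

Lemma planar_3tree_edges :
  exists F, planar_3tree [set: 'I_n]%SET edges F /\ outer \in F.
Proof.
have [//|//|F [tree out _]] := @planar_3tree_below n.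
exists F; split; last exact: mem_rem out.
have <- : [set i : 'I_n | (i < n)%N]%SET = [set: 'I_n]%SET
  by apply/setP=> i; rewrite !inE ltn_ord.
exact: tree.
Qed.

End Graph.

(** * Coordinates of the drawing and intersections of its edges *)

Section Position.
Variable R : realType.

Definition sg (s : bool) : R := if s then 1 else -1.

Definition place (v : vert) : R * R :=
  match v with
  | Va s => (sg s, 1)
  | Vb => (0, -1)
  | Vd => (0, 0)
  | Vz => (0, 2)
  | Vu s i => (sg s * (4 * 2 ^+ i - 2), 0)
  end.

Lemma pow2_ge1 i : 1 <= 2 ^+ i :> R.
Proof. by rewrite exprn_ege1 // ler1n. Qed.

Lemma pow2_lt i j : (i < j)%N -> 2 * 2 ^+ i <= 2 ^+ j :> R.
Proof. by move=> ij; rewrite -exprS ler_eXn2l // ltr1n. Qed.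

Lemma pow2_inj i j : 2 ^+ i = 2 ^+ j :> R -> i = j.
Proof.
move=> e; have := pow2_ge1 i; have := pow2_ge1 j => Hj Hi.
by have [/pow2_lt h|/pow2_lt h|//] := ltngtP i j; exfalso; lra.
Qed.

(** At [i = 0] the formula gives the origin, so d behaves like a chain vertex of index -1. *)
Lemma place_prev s i : place (prev s i) = (sg s * (2 * 2 ^+ i - 2), 0).
Proof.
case: i => [|i] /=; first by rewrite expr0 mulr1 subrr mulr0.
by rewrite exprS mulrA -natrM.
Qed.

(* One constructor per family of edges up to the reflection exchanging a with c
   and u_i with w_i; thus [Kab false] is the edge bc and [Kuu s 0] starts at d. *)
Inductive kind :=
  Kab of bool | Kac | Kda of bool | Kdb | Kza of bool | Kzd
| Kua of bool & nat | Kub of bool & nat | Kuu of bool & nat.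

Definition ends (e : kind) : vert * vert :=
  match e with
  | Kab true => (Vb, Va true) | Kab false => (Va false, Vb)
  | Kac => (Va false, Va true)
  | Kda s => (Vd, Va s) | Kdb => (Vd, Vb)
  | Kza s => (Vz, Va s) | Kzd => (Vz, Vd)
  | Kua s i => (Vu s i, Va s) | Kub s i => (Vu s i, Vb)
  | Kuu s i => (Vu s i, prev s i)
  end.

Lemma kind_of_parent v x : x \in parents v -> exists e, ends e = (v, x).
Proof.
case: v => [[]||||s i]; rewrite /= ?inE //.
- by case/orP=> /eqP->; [exists Kac | exists (Kab false)].
- by move/eqP->; exists (Kab true).
- by case/or3P=> /eqP->; [exists (Kda true) | exists Kdb | exists (Kda false)].
- by case/or3P=> /eqP->; [exists (Kza true) | exists (Kza false) | exists Kzd].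
- by case/or3P=> /eqP->; [exists (Kua s i) | exists (Kub s i) | exists (Kuu s i)].
Qed.

(** The closed segments as linear constraints, parametrised by [p.2], or by [p.1] on the horizontal
    edges. *)
Definition on_edge (e : kind) (p : R * R) : Prop :=
  match e with
  | Kab s => -1 <= p.2 <= 1 /\ p.1 = sg s * ((1 + p.2) / 2)
  | Kac => -1 <= p.1 <= 1 /\ p.2 = 1
  | Kda s => 0 <= p.2 <= 1 /\ p.1 = sg s * p.2
  | Kdb => -1 <= p.2 <= 0 /\ p.1 = 0
  | Kza s => 1 <= p.2 <= 2 /\ p.1 = sg s * (2 - p.2)
  | Kzd => 0 <= p.2 <= 2 /\ p.1 = 0
  | Kua s i => 0 <= p.2 <= 1 /\
      p.1 = sg s * (p.2 + (4 * 2 ^+ i - 2) * (1 - p.2))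
  | Kub s i => -1 <= p.2 <= 0 /\
      p.1 = sg s * ((4 * 2 ^+ i - 2) * (1 + p.2))
  | Kuu s i => 2 * 2 ^+ i - 2 <= sg s * p.1 <= 4 * 2 ^+ i - 2 /\ p.2 = 0
  end.

Lemma segment_on e p : segment (place (ends e).1) (place (ends e).2) p -> on_edge e p.
Proof.
case=> t /andP[t0 t1] ->.
case: e => [[]||[]||[]||[] i|[] i|s i] /=; rewrite ?place_prev /=;
  try by split; [apply/andP; split|]; rewrite /sg; lra.
have p1 := pow2_ge1 i.
have h1 : 0 <= t * (2 ^+ i) by apply: mulr_ge0; lra.
have h2 : 0 <= (1 - t) * (2 ^+ i) by apply: mulr_ge0; lra.
by split; [apply/andP; split|]; case: s; rewrite /sg; lra.
Qed.

Lemma vertex_on e v : on_edge e (place v) -> v = (ends e).1 \/ v = (ends e).2.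
Proof.
have key s i s' j : sg s * (4 * 2 ^+ i - 2) = sg s' * (4 * 2 ^+ j - 2) -> Vu s i = Vu s' j.
  have := pow2_ge1 i; have := pow2_ge1 j => Hj Hi.
  case: s s' => -[]; rewrite /sg => h; try by exfalso; lra.
    by congr Vu; apply: pow2_inj; lra.
  by congr Vu; apply: pow2_inj; lra.
case: e => [s||s||s||s i|s i|s i]; case: v => [s'||||s' j] /= [/andP[h1 h2] h3];
  try (have Hi := pow2_ge1 i); try (have Hj := pow2_ge1 j);
  try (by exfalso; move: h1 h2 h3; rewrite /sg; try case: s; try case: s'; lra);
  try (by left); try (by right);
  try (by move: h1 h2 h3; rewrite /sg; case: s; case: s' => h1 h2 h3;
     (by left + by right + by exfalso; lra)).
all: try (by move: h1 h2 h3; rewrite /sg; case: s' => h1 h2 h3;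
     (by left + by right + by exfalso; lra)).
- by clear h3; case: s; [left|right].
- by left; apply/key; rewrite h3; ring.
- by left; apply/key; rewrite h3; ring.
- right; case: i h1 {h2 Hi} => [|i] // h1; exfalso; move: h1.
  by rewrite mulr0 exprS; have := pow2_ge1 i; lra.
have ss : s' = s.
  by move: h1 h2; case: s; case: s' => //; rewrite /sg; lra.
subst s'; have {h1 h2}[h1 h2] : (2 * 2 ^+ i <= 4 * 2 ^+ j :> R) /\ (2 ^+ j <= 2 ^+ i :> R).
  by move: h1 h2; clear; case: s; rewrite /sg; lra.
have [ij|ij|->] := ltngtP i j; [by exfalso; have := pow2_lt ij; lra| |by left].
case: i ij h1 h2 Hi => // i; rewrite ltnS leq_eqVlt => /orP[/eqP->|ij]; first by right.
by rewrite exprS => h1 h2 _; exfalso; have := pow2_lt ij; lra.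
Qed.


(* The last component of each clause is redundant: it supplies the products that
   turn the comparison of two edges into a linear problem. *)
Definition on_open (e : kind) (x y : R) : Prop :=
  match e with
  | Kab s => [/\ -1 < y, y < 1, x = sg s * ((1 + y) / 2) & 0 < 1 + y]
  | Kac => [/\ -1 < x, x < 1, y = 1 & 0 < y]
  | Kda s => [/\ 0 < y, y < 1, x = sg s * y & 0 < y]
  | Kdb => [/\ -1 < y, y < 0, x = 0 & 0 < 1 + y]
  | Kza s => [/\ 1 < y, y < 2, x = sg s * (2 - y) & 0 < y]
  | Kzd => [/\ 0 < y, y < 2, x = 0 & 0 < y]
  | Kua s i => [/\ 0 < y, y < 1, x = sg s * (y + (4 * 2 ^+ i - 2) * (1 - y))
                 & 0 <= (2 ^+ i - 1) * (1 - y)]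
  | Kub s i => [/\ -1 < y, y < 0, x = sg s * ((4 * 2 ^+ i - 2) * (1 + y))
                 & 0 <= (2 ^+ i - 1) * (1 + y)]
  | Kuu s i => [/\ 2 * 2 ^+ i - 2 < sg s * x, sg s * x < 4 * 2 ^+ i - 2, y = 0
                 & 1 <= 2 ^+ i :> R]
  end.

Lemma on_openW e p : on_edge e p -> p <> place (ends e).1 -> p <> place (ends e).2 ->
  on_open e p.1 p.2.
Proof.
have pE v : p <> place v -> ~ (p.1 = (place v).1 /\ p.2 = (place v).2).
  by move=> pv [h1 h2]; apply: pv; case: p (place v) h1 h2 => ? ? [? ?] /= -> ->.
move=> h /pE n1 /pE n2; move: p h n1 n2 {pE} => [x y] /=.
have lt a b : a <= b -> a <> b -> a < b :> R.
  by move=> ab nab; rewrite lt_neqAle ab andbT; apply/eqP.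
case: e => [[]||[]||[]||[] i|[] i|[] i] /= [/andP[h1 h2] h3] n1 n2;
  try have Hi := pow2_ge1 i; rewrite ?place_prev /= in n1 n2;
  rewrite /sg in h1 h2 h3 n1 n2 *;
  (have l1 := lt _ _ h1; have l2 := lt _ _ h2);
  (* Equality in either bound would put the point at an end of the edge. *)
  specialize (l1 ltac:(intro E; try subst y;
    first [apply: n1; split; lra | apply: n2; split; lra]));
  specialize (l2 ltac:(intro E; try subst y;
    first [apply: n1; split; lra | apply: n2; split; lra]));
  split => //; by [lra | apply: mulr_ge0; lra].
Qed.

Definition crossing_pair (e f : kind) : Prop :=
  (exists s, e = Kuu s 0 /\ f = Kab s) \/ (e = Kzd /\ f = Kac).

(** [Kab s] meets the first axis at [sg s / 2], between d and u_0 or w_0, while the chain edges with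
    [j >= 1] begin at distance 2 or more from the origin. *)
Lemma crossing_ab_uu s s' j x y :
  on_open (Kab s) x y -> on_open (Kuu s' j) x y -> s' = s /\ j = 0%N.
Proof.
move=> [h1 h2 h3 h4] [g1 g2 g3 g4]; subst y.
have ss : s' = s.
  by move: h3 g1 g4; clear; case: s; case: s' => //; rewrite /sg => *; exfalso; lra.
subst s'; split=> //; case: j g1 {g2 g4} => // j; rewrite exprS h3; have := pow2_ge1 j.
by case: s {h3}; rewrite /sg => ? g1; exfalso; lra.
Qed.

(** Most pairs are separated by height or by the sign of [x]. The others are two edges of one fan at
    a, b or c, two edges along the first axis, and the crossing pairs. *)
Lemma crossing_kinds e f x y : on_open e x y -> on_open f x y ->
  [\/ e = f, crossing_pair e f | crossing_pair f e].
Proof.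
(* In a fan, [a] is the vertical distance to the common apex; the remaining coordinate then
   determines the edge. *)
have pair_uniq s s' i j a : 0 < a -> 0 <= (2 ^+ i - 1) * a -> 0 <= (2 ^+ j - 1) * a ->
    sg s * ((4 * 2 ^+ i - 2) * a) = sg s' * ((4 * 2 ^+ j - 2) * a) ->
    s = s' /\ i = j.
  move=> a0 hi hj h; have ss : s = s'.
    by move: h; case: s; case: s' => //; rewrite /sg => h; exfalso; lra.
  subst s'; split=> //; apply: pow2_inj.
  have an0 : a != 0 by rewrite gt_eqF.
  by apply: (mulIf an0); move: h; case: s; rewrite /sg; lra.
case: e => [s||s||s||s i|s i|s i]; case: f => [s'||s'||s'||s' j|s' j|s' j] he hf;
  case: (he) (hf) => h1 h2 h3 h4 [g1 g2 g3 g4];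
  try (by exfalso; lra);
  try (by exfalso; move: h1 h2 h3 h4 g1 g2 g3 g4; try case: s he; try case: s' hf;
          rewrite /sg; lra).
- constructor 1; move: h3; rewrite g3; case: s {he}; case: s' {hf g3} => //.
    by rewrite /sg => ?; exfalso; lra.
  by rewrite /sg => ?; exfalso; lra.
- by have [-> ->] := crossing_ab_uu he hf; constructor 3; left; exists s.
- by constructor 1.
- by constructor 3; right.
- constructor 1; move: h3; rewrite g3; case: s {he}; case: s' {hf g3} => //.
    by rewrite /sg => ?; exfalso; lra.
  by rewrite /sg => ?; exfalso; lra.
- by constructor 1.
- constructor 1; move: h3; rewrite g3; case: s {he}; case: s' {hf g3} => //.
    by rewrite /sg => ?; exfalso; lra.
  by rewrite /sg => ?; exfalso; lra.
- by constructor 2; right.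
- by constructor 1.
- have ss : s = s'.
    move: h3 g3; case: s {he}; case: s' {hf} => //; rewrite /sg => h3 g3; exfalso; lra.
  subst s'; have [||||_ ->] := pair_uniq s s i j (1 - y) => //; first by lra.
    by move: h3 g3; clear; case: s; rewrite /sg; lra.
  by constructor 1.
- have [||||-> ->] := pair_uniq s s' i j (1 + y) => //; [by lra|by rewrite -h3|].
  by constructor 1.
- by have [-> ->] := crossing_ab_uu hf he; constructor 2; left; exists s'.
- have ss : s = s'.
    by move: h1 h2 g1 g2; case: s {he}; case: s' {hf} => //; rewrite /sg => *; exfalso; lra.
  subst s'; have [ij|ij|->] := ltngtP i j; last by constructor 1.
    by exfalso; have := pow2_lt ij; lra.
  by exfalso; have := pow2_lt ij; lra.
Qed.
End Position.

(** * Overlaps of the ply-disks *)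

Section Disks.
Variable R : realType.

Local Notation place := (@place R).

(** Squaring keeps the comparisons of distances polynomial. *)
Definition sqdist (p q : R * R) : R := (p.1 - q.1) ^+ 2 + (p.2 - q.2) ^+ 2.

Lemma sqdist_ge0 p q : 0 <= sqdist p q.
Proof. by rewrite addr_ge0 ?sqr_ge0. Qed.

Lemma sqdistC p q : sqdist p q = sqdist q p.
Proof. by rewrite /sqdist; ring. Qed.

Lemma edist_le p q (r : R) : 0 <= r -> (Defs.edist p q <= r) = (sqdist p q <= r ^+ 2).
Proof.
move=> r0; rewrite -[in RHS](sqr_sqrtr (sqdist_ge0 p q)) ler_sqr ?nnegrE //.
Qed.

Lemma edist_lt p q (r : R) : 0 <= r -> (Defs.edist p q < r) = (sqdist p q < r ^+ 2).
Proof.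
move=> r0; rewrite -[in RHS](sqr_sqrtr (sqdist_ge0 p q)) ltr_sqr ?nnegrE //.
Qed.

(** Since a, b, c add at most 3 to the ply at any point, only the other disks have to be controlled:
    at most 2 at a point and at most 1 at a vertex. *)
Definition core (v : vert) : bool :=
  match v with Va _ | Vb => false | _ => true end.

(** For a [core] vertex, an upper bound on the ply-radius; at u_i it is half the distance [4 * 2^i]
    to u_(i+1). *)
Definition rad (v : vert) : R := if v is Vu _ i then 2 * 2 ^+ i else 1.

(** The number of steps from d along a chain, z counting like d; overlapping [core] disks will have
    consecutive levels. *)
Definition level (v : vert) : nat := if v is Vu _ i then i.+1 else 0%N.

Lemma rad_ge0 v : 0 <= rad v.
Proof. by case: v => //= _ i; have := pow2_ge1 R i; lra. Qed.

Lemma rad_prev s i : rad (prev s i) = 2 ^+ i.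
Proof. by case: i => [|i] /=; rewrite ?expr0 // exprS. Qed.

Lemma edge_sqdist v x : x \in parents v ->
  (core v -> sqdist (place v) (place x) <= (2 * rad v) ^+ 2) /\
  (core x -> sqdist (place v) (place x) <= (2 * rad x) ^+ 2).
Proof.
case/kind_of_parent=> -[[]||s||s||s i|s i|s i] [<- <-]; rewrite /sqdist /=;
  split=> // _; try (by try case: s; rewrite /sg; lra).
- have := pow2_ge1 R i => Hi; have : 0 <= (2 ^+ i - 1) * 2 ^+ i :> R by apply: mulr_ge0; lra.
  by case: s; rewrite /sg; lra.
- have := pow2_ge1 R i => Hi; have : 0 <= (2 ^+ i - 1) * 2 ^+ i :> R by apply: mulr_ge0; lra.
  by case: s; rewrite /sg; lra.
- have := pow2_ge1 R i => Hi; have : 0 <= (2 ^+ i - 1) * 2 ^+ i :> R by apply: mulr_ge0; lra.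
  by rewrite place_prev /=; case: s; rewrite /sg; lra.
- by rewrite place_prev rad_prev /=; case: s; rewrite /sg; lra.
Qed.

Lemma sqdist_lt p q (r : R) : 0 <= r -> sqdist p q < r ^+ 2 ->
  [/\ p.1 - r < q.1, q.1 < p.1 + r, p.2 - r < q.2 & q.2 < p.2 + r].
Proof.
rewrite /sqdist => r0 h.
have [] : `|p.1 - q.1| < r /\ `|p.2 - q.2| < r.
  have := sqr_ge0 (p.1 - q.1); have := sqr_ge0 (p.2 - q.2) => h2 h1.
  by rewrite -!(ltr_sqr (normr_ge0 _)) ?nnegrE // !real_normK ?num_real //; split; lra.
by rewrite !ltr_norml => /andP[? ?] /andP[? ?]; split; lra.
Qed.

(** The interval begins at u_(i-1) and ends before [8 * 2^i - 2], where that of u_(i+2) begins: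
    hence only consecutive disks of a chain overlap. *)
Lemma Vu_disk s i p : sqdist (place (Vu s i)) p < rad (Vu s i) ^+ 2 ->
  2 * 2 ^+ i - 2 < sg R s * p.1 < 6 * 2 ^+ i - 2.
Proof.
move=> /(sqdist_lt (rad_ge0 _)) /= [h1 h2 _ _]; apply/andP.
by move: h1 h2; case: s; rewrite /sg => h1 h2; split; lra.
Qed.

(** The open unit disks of d and z are tangent. They stay within distance 1 of the second axis,
    whereas the disk of u_1 begins at 2. The two chains lie on opposite sides of that axis, and
    within a chain [Vu_disk] applies. *)
Lemma disks_level v v' p : core v -> core v' -> v <> v' ->
  sqdist (place v) p < rad v ^+ 2 -> sqdist (place v') p < rad v' ^+ 2 ->
  level v' = (level v).+1 \/ level v = (level v').+1.
Proof.
have small w s i : core w -> level w = 0%N -> sqdist (place w) p < rad w ^+ 2 ->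
    sqdist (place (Vu s i)) p < rad (Vu s i) ^+ 2 -> i = 0%N.
  case: w => //= _ _ /(sqdist_lt ler01) /= [h1 h2 _ _] /Vu_disk /andP[h _];
  case: i h => // i; rewrite exprS; have := pow2_ge1 R i;
  by move=> ?; case: s; rewrite /sg => ?; exfalso; lra.
have dz : sqdist (place Vd) p < 1 ^+ 2 -> sqdist (place Vz) p < 1 ^+ 2 -> False.
  by move=> /(sqdist_lt ler01) /= [_ _ _ ?] /(sqdist_lt ler01) /= [_ _ ? _]; lra.
case: v => [//|//|||s i]; case: v' => [//|//|||s' j] _ _ // nv h h'.
- by case: (dz h h').
- by rewrite (small Vd s' j) //; left.
- by case: (dz h' h).
- by rewrite (small Vz s' j) //; left.
- by rewrite (small Vd s i) //; right.
- by rewrite (small Vz s i) //; right.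
have := Vu_disk h; have := Vu_disk h' => /andP[g1 g2] /andP[h1 h2].
have Hi := pow2_ge1 R i; have Hj := pow2_ge1 R j.
have ss : s = s'.
  by move: g1 h1; clear -Hi Hj; case: s; case: s' => //; rewrite /sg => *; exfalso; lra.
subst s'; rewrite /=.
have far a b : (a.+1 < b)%N -> 2 ^+ b < 3 * 2 ^+ a :> R -> False.
  by move=> /(pow2_lt R); rewrite exprS; have := pow2_ge1 R a; lra.
have [ij|ij|ij] := ltngtP i j; last by case: nv; rewrite ij.
  move: ij; rewrite leq_eqVlt => /orP[/eqP<-|ij]; first by left.
  by exfalso; apply: (far i j) => //; lra.
move: ij; rewrite leq_eqVlt => /orP[/eqP<-|ij]; first by right.
by exfalso; apply: (far j i) => //; lra.
Qed.

(* The only vertex other than a, b, c whose ply-disk may contain w (no such disk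
   contains b). *)
Definition host (w : vert) : vert := if w is Va s then Vu s 0 else w.

(** The circle of radius [rad] around u_i passes through u_(i-1), so the open disk leaves it out;
    u_(i+1) is twice as far away. *)
Lemma vertex_disk v w : core v -> sqdist (place v) (place w) < rad v ^+ 2 -> v = host w.
Proof.
case: v => [//|//|||s i] _.
- move=> /(sqdist_lt ler01); case: w => [s||||s i] //= [h1 h2 h3 h4]; try (by exfalso; lra).
  by exfalso; move: h1 h2; have := pow2_ge1 R i; case: s; rewrite /sg; lra.
- by move=> /(sqdist_lt ler01); case: w => [s||||s i] //= [h1 h2 h3 h4]; exfalso; lra.
have Hi := pow2_ge1 R i.
move=> /Vu_disk /andP[]; case: w => [s'||||s' j] /= h1 h2;
  try (by exfalso; move: h1 h2; case: s; rewrite /sg; lra).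
- have ss : s = s' by move: h1; clear -Hi; case: s; case: s' => //; rewrite /sg => *; exfalso; lra.
  subst s'; case: i h1 {h2 Hi} => // i; rewrite exprS; have := pow2_ge1 R i.
  by case: s; rewrite /sg => ? ?; exfalso; lra.
have Hj := pow2_ge1 R j.
have ss : s = s' by move: h1; clear -Hi Hj; case: s; case: s' => //; rewrite /sg => *; exfalso; lra.
subst s'; congr Vu.
have {h1 h2}[h1 h2] : (2 ^+ i < 2 * 2 ^+ j :> R) /\ (2 * 2 ^+ j < 3 * 2 ^+ i :> R).
  by move: h1 h2; clear; case: s; rewrite /sg => *; split; lra.
by have [/(pow2_lt R)|/(pow2_lt R)|//] := ltngtP i j => ?; exfalso; lra.
Qed.

End Disks.

(** * Crossings and ply of the drawing *)

Lemma set2_eq (T : finType) (a b c d : T) : [set a; b]%SET = [set c; d]%SET ->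
  (a = c /\ b = d) \/ (a = d /\ b = c).
Proof.
move=> /setP h.
have ha : a = c \/ a = d by have := h a; rewrite !inE eqxx => /esym/orP[]/eqP; auto.
have hb : b = c \/ b = d by have := h b; rewrite !inE eqxx orbT => /esym/orP[]/eqP; auto.
have hc : c = a \/ c = b by have := h c; rewrite !inE eqxx => /orP[]/eqP; auto.
have hd : d = a \/ d = b by have := h d; rewrite !inE eqxx orbT => /orP[]/eqP; auto.
by case: ha => ha; case: hb => hb; case: hc => hc; case: hd => hd; subst; auto.
Qed.

Lemma segmentC (R : realType) (p q : R * R) : (segment p q `<=` segment q p)%classic.
Proof.
move=> x [t /andP[t0 t1] ->]; exists (1 - t); first by apply/andP; split; lra.
by congr pair; ring.
Qed.

Lemma place_inj (R : realType) : injective (@place R).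
Proof.
move=> v w h; move: (congr1 fst h) (congr1 snd h) => {h}.
case: v => [s||||s i]; case: w => [s'||||s' j] //= h1 h2;
  try (by exfalso; lra).
- by move: h1; case: s; case: s' => //; rewrite /sg => *; exfalso; lra.
- by exfalso; move: h1; have := pow2_ge1 R j; case: s'; rewrite /sg; lra.
- by exfalso; move: h1; have := pow2_ge1 R i; case: s; rewrite /sg; lra.
have Hi := pow2_ge1 R i; have Hj := pow2_ge1 R j.
have ss : s = s' by move: h1; clear -Hi Hj; case: s; case: s' => //; rewrite /sg => *; exfalso; lra.
subst s'; congr Vu; apply: (@pow2_inj R).
by move: h1; clear; case: s; rewrite /sg => *; lra.
Qed.

Section Drawing.
Variables (R : realType) (k : nat).
Notation n := (k.*2).+4.+1.
Notation ord_of := (ord_of k).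
Notation edges := (edges k).

Definition drawing (i : 'I_n) : R * R := place R (vert_of i).

Definition edge_of (e : kind) : {set 'I_n} :=
  [set ord_of (ends e).1; ord_of (ends e).2]%SET.

Lemma label_Vu s i : (i < k)%N -> (label (Vu s i) < n)%N.
Proof. by rewrite /=; case: s; lia. Qed.

Lemma label_ends e : (label (ends e).1 < n)%N -> (label (ends e).2 < n)%N.
Proof.
case: e => [[]||[]||[]||[] i|s i|s [|i]] //=; case: s => //=; lia.
Qed.

Lemma ends_parents e : (ends e).2 \in parents (ends e).1.
Proof.
by case: e => [[]||[]||[]||s i|s i|s i]; rewrite /= !inE ?eqxx ?orbT.
Qed.

Lemma edge_of_edges e : (label (ends e).1 < n)%N -> edge_of e \in edges.
Proof.
move=> l1; apply/edgesP; exists (ord_of (ends e).1), (ord_of (ends e).2).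
by rewrite !ord_ofK ?label_ends // ends_parents.
Qed.

Lemma edges_kind (e : {set 'I_n}) : e \in edges ->
  exists2 f, (label (ends f).1 < n)%N & e = edge_of f.
Proof.
case/edgesP=> v [x [/kind_of_parent[f ef] ->]]; exists f.
  by rewrite ef /= label_vert_of.
by rewrite /edge_of ef /= !vert_ofK.
Qed.

Lemma edge_segment_on e p : (label (ends e).1 < n)%N ->
  edge_segment drawing (edge_of e) p -> on_edge e p.
Proof.
move=> l1 [u [v [/set2_eq[] [<- <-]]]]; rewrite /drawing !ord_ofK ?label_ends //.
  exact: segment_on.
by move/segmentC; exact: segment_on.
Qed.

Lemma ord_of_mem e v : (v = (ends e).1 \/ v = (ends e).2) -> ord_of v \in edge_of e.
Proof. by rewrite inE !inE => -[]->; rewrite eqxx ?orbT. Qed.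

Lemma drawing_straight : straight_line_drawing edges drawing.
Proof.
split; first by move=> i j /place_inj/vert_of_inj.
move=> e v /edges_kind[f lf ->] vf /(edge_segment_on lf)/vertex_on/ord_of_mem.
by rewrite vert_ofK (negPf vf).
Qed.

Lemma ord_of_eq v w : (label v < n)%N -> (label w < n)%N ->
  (ord_of v == ord_of w) = (v == w).
Proof. by move=> lv lw; rewrite -(inj_eq (@vert_of_inj k)) !ord_ofK. Qed.

Definition crossing (e f : kind) : {set {set 'I_n}} := [set edge_of e; edge_of f]%SET.

Lemma crossing_mem e f : crossing_pair e f ->
  crossing e f \in [set crossing (Kuu true 0) (Kab true);
     crossing (Kuu false 0) (Kab false); crossing Kzd Kac]%SET.
Proof. by case=> [[[] [-> ->]]|[-> ->]]; rewrite !inE eqxx ?orbT. Qed.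

Lemma cross_mem e f : e \in edges -> f \in edges -> cross drawing e f ->
  [set e; f]%SET \in [set crossing (Kuu true 0) (Kab true);
     crossing (Kuu false 0) (Kab false); crossing Kzd Kac]%SET.
Proof.
move=> /edges_kind[e' le ->] /edges_kind[f' lf ->] [nef [p [pe pf np]]].
have oe := edge_segment_on le pe; have onf := edge_segment_on lf pf.
have pn v : p <> place R v.
  move=> pv; rewrite pv in oe onf.
  have ve := vertex_on oe; have vf := vertex_on onf.
  apply: (np (ord_of v)); rewrite ?ord_of_mem // /drawing ord_ofK //.
  by case: ve => ->; rewrite ?label_ends.
have [ef|cp|cp] := crossing_kinds (on_openW oe (pn _) (pn _)) (on_openW onf (pn _) (pn _)).
- by case: nef; rewrite ef.
- exact: crossing_mem.
- by rewrite finset.setUC; exact: crossing_mem.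
Qed.

(** A point other than the two ends of [e] is no common end, and an end of [e] that is not an end of
    [f] makes the edges distinct. *)
Lemma cross_of e f p : (label (ends e).1 < n)%N -> (label (ends f).1 < n)%N ->
  segment (place R (ends e).1) (place R (ends e).2) p ->
  segment (place R (ends f).1) (place R (ends f).2) p ->
  p <> place R (ends e).1 -> p <> place R (ends e).2 ->
  (ends e).1 != (ends f).1 -> (ends e).1 != (ends f).2 ->
  cross drawing (edge_of e) (edge_of f).
Proof.
move=> le lf pe pf n1 n2 ne1 ne2.
have eseg g : (label (ends g).1 < n)%N ->
    segment (place R (ends g).1) (place R (ends g).2) p -> edge_segment drawing (edge_of g) p.
  move=> lg pg; exists (ord_of (ends g).1), (ord_of (ends g).2); split=> //.
  by rewrite /drawing !ord_ofK ?label_ends.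
split.
  move=> /setP/(_ (ord_of (ends e).1)).
  by rewrite !inE eqxx !ord_of_eq ?label_ends // (negPf ne1) (negPf ne2).
exists p; split; [exact: eseg | exact: eseg |].
by move=> v; rewrite !inE => /orP[]/eqP-> _; rewrite /drawing ord_ofK // label_ends.
Qed.

Hypothesis k2 : (2 <= k)%N.

Lemma crossing_pair_cross e f : crossing_pair e f -> 
  [/\ edge_of e \in edges, edge_of f \in edges & cross drawing (edge_of e) (edge_of f)].
Proof.
case=> [[s [-> ->]]|[-> ->]].
  have l0 : (label (Vu s 0) < n)%N by apply: label_Vu; lia.
  have l1 : (label (ends (Kab s)).1 < n)%N by case: s {l0}.
  split; [exact: edge_of_edges | exact: edge_of_edges |].
  apply: (@cross_of _ _ (sg R s / 2, 0)) => //=.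
  - exists (3 / 4); first by apply/andP; split; lra.
    by rewrite /= expr0; congr pair; case: s {l0 l1}; rewrite /sg; lra.
  - exists (1 / 2); first by apply/andP; split; lra.
    by case: s {l0 l1}; rewrite /= /sg; congr pair; lra.
  - by case=> h; case: s h {l0 l1}; rewrite /sg expr0; lra.
  - by case=> h; case: s h {l0 l1}; rewrite /sg; lra.
  - by case: s {l0 l1}.
  - by case: s {l0 l1}.
split; [exact: edge_of_edges | exact: edge_of_edges |].
apply: (@cross_of _ _ (0, 1)) => //=.
- exists (1 / 2); first by apply/andP; split; lra.
  by rewrite /=; congr pair; lra.
- exists (1 / 2); first by apply/andP; split; lra.
  by rewrite /= /sg; congr pair; lra.
- by case; lra.
- by case; lra.
Qed.

Lemma crossing_neq e f e' f' : (label (ends e).1 < n)%N ->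
  (label (ends e').1 < n)%N -> (label (ends f').1 < n)%N ->
  (ends e).1 \notin [:: (ends e').1; (ends e').2; (ends f').1; (ends f').2] ->
  crossing e f != crossing e' f'.
Proof.
move=> le le' lf'; rewrite !inE !negb_or => /and4P[n1 n2 n3 n4].
apply/eqP=> /setP/(_ (edge_of e)); rewrite !inE eqxx => /esym/orP[]/eqP/setP;
move=> /(_ (ord_of (ends e).1)); rewrite !inE eqxx !ord_of_eq ?label_ends //.
  by rewrite (negPf n1) (negPf n2).
by rewrite (negPf n3) (negPf n4).
Qed.

Lemma num_crossings_drawing : num_crossings edges drawing = 3%N.
Proof.
have lu s : (label (Vu s 0) < n)%N by apply: label_Vu; lia.
transitivity #|[set crossing (Kuu true 0) (Kab true);
     crossing (Kuu false 0) (Kab false); crossing Kzd Kac]%SET|.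
  apply: eq_card => X; rewrite [in LHS]inE; apply/asboolP/idP.
    by move=> [e [f [ee fe cef ->]]]; exact: cross_mem.
  have mk e f : crossing_pair e f -> exists a b, [/\ a \in edges, b \in edges,
      cross drawing a b & crossing e f = [set a; b]%SET].
    by move=> /crossing_pair_cross[h1 h2 h3]; exists (edge_of e), (edge_of f).
  rewrite !inE -orbA => /or3P[]/eqP->; apply: mk; [left|left|by right].
    by exists true.
  by exists false.
have n1 : crossing (Kuu true 0) (Kab true) != crossing (Kuu false 0) (Kab false).
  by apply: crossing_neq => //; exact: lu.
have n2 s : crossing Kzd Kac != crossing (Kuu s 0) (Kab s).
  by apply: crossing_neq => //; [exact: lu | case: s | case: s].
by rewrite finset.setUC cardsU1 cards2 n1 in_set2 (negPf (n2 _)) (negPf (n2 _)).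
Qed.

Lemma ply_radius_core i : core (vert_of i) -> ply_radius edges drawing i <= rad R (vert_of i).
Proof.
move=> ci; rewrite /ply_radius ler_pdivrMr //.
apply: bigmax_le; first by rewrite mulr_ge0 ?rad_ge0.
move=> u /edgesP[v [x [/edge_sqdist-/(_ R)[hv hx] /set2_eq[] [ei eu]]]].
all: rewrite edist_le ?mulr_ge0 ?rad_ge0 // mulrC ei eu.
  by apply: hv; rewrite -ei.
by rewrite sqdistC; apply: hx; rewrite -ei.
Qed.

Lemma core_outer i : core (vert_of i) = (i \notin outer k).
Proof. by rewrite inE; case: (vert_of i) => [[]||||s j]. Qed.

Lemma core_disk i p : core (vert_of i) -> p \in ply_disk edges drawing i ->
  sqdist (place R (vert_of i)) p < rad R (vert_of i) ^+ 2.
Proof.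
move=> ci; rewrite inE /= -edist_lt ?rad_ge0 // => h.
exact: lt_le_trans h (ply_radius_core ci).
Qed.

Definition core_at (p : R * R) : {set 'I_n} :=
  [set i | core (vert_of i) & p \in ply_disk edges drawing i]%SET.

Lemma mem_core_at p i :
  (i \in core_at p) = core (vert_of i) && (p \in ply_disk edges drawing i).
Proof. exact: finset.in_set. Qed.

Lemma ply_at_core p : (ply_at edges drawing p <= 3 + #|core_at p|)%N.
Proof.
rewrite /ply_at -(card_outer k).
apply: leq_trans (leq_card_setU _ _); apply: subset_leq_card.
apply/fintype.subsetP=> i; rewrite finset.in_setU mem_core_at finset.in_set => h.
by rewrite h andbT core_outer orbN.
Qed.

(* Three levels cannot pairwise differ by exactly one. *)
Lemma card_core_at p : (#|core_at p| <= 2)%N.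
Proof.
rewrite leqNgt; apply/card_gt2P=> -[x [y [z [[hx hy hz] [xy yz zx]]]]].
have lev i j : i \in core_at p -> j \in core_at p -> i != j ->
    level (vert_of j) = (level (vert_of i)).+1 \/ level (vert_of i) = (level (vert_of j)).+1.
  rewrite !mem_core_at => /andP[ci di] /andP[cj dj] ij.
  apply: (@disks_level R _ _ p) => //; [|exact: core_disk|exact: core_disk].
  by move/vert_of_inj/eqP; rewrite (negPf ij).
have := lev _ _ hx hy xy; have := lev _ _ hy hz yz; have := lev _ _ hz hx zx.
lia.
Qed.

Lemma card_core_at_vertex v : (#|core_at (drawing v)| <= 1)%N.
Proof.
rewrite leqNgt; apply/card_gt1P=> -[x [y [hx hy xy]]].
have hst i : i \in core_at (drawing v) -> vert_of i = host (vert_of v).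
  by rewrite mem_core_at => /andP[ci /(core_disk ci)/(vertex_disk ci)].
by case/eqP: xy; apply: vert_of_inj; rewrite (hst x) // (hst y).
Qed.

(** The edge [e] at [v] forces a ply-radius of at least half its length; [2 ^+ 2] is this half after
    squaring. *)
Lemma in_disk e v p : (label (ends e).1 < n)%N ->
  v = (ends e).1 \/ v = (ends e).2 ->
  2 ^+ 2 * sqdist (place R v) p < sqdist (place R (ends e).1) (place R (ends e).2) ->
  ply_disk edges drawing (ord_of v) p.
Proof.
move=> le ve h.
have lv : (label v < n)%N by case: ve => ->; rewrite ?label_ends.
have [w [lw ew hw]] : exists w, [/\ (label w < n)%N, [set ord_of v; ord_of w]%SET = edge_of e
     & sqdist (place R (ends e).1) (place R (ends e).2) = sqdist (place R v) (place R w)].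
  case: ve => ->; first by exists (ends e).2; rewrite label_ends.
  by exists (ends e).1; split=> //; [rewrite finset.setUC | rewrite sqdistC].
rewrite /ply_disk /= /ply_radius ltr_pdivlMr //.
have lt : Defs.edist (drawing (ord_of v)) p * 2 <
    Defs.edist (drawing (ord_of v)) (drawing (ord_of w)).
  rewrite /drawing !ord_ofK // ltNge edist_le ?mulr_ge0 ?sqrtr_ge0 // -ltNge.
  by rewrite exprMn (sqr_sqrtr (sqdist_ge0 _ _)) mulrC -hw.
apply: lt_le_trans lt _.
by apply: (le_bigmax_cond _ (fun u => Defs.edist (drawing (ord_of v)) (drawing u)));
   rewrite ew edge_of_edges.
Qed.

Lemma ply_at_ge p (s : seq vert) : uniq s ->
  (forall v, v \in s -> (label v < n)%N /\ ply_disk edges drawing (ord_of v) p) ->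
  (size s <= ply_at edges drawing p)%N.
Proof.
move=> us hs; rewrite /ply_at -(size_map ord_of).
have u : uniq [seq ord_of v | v <- s].
  rewrite map_inj_in_uniq // => v w /hs[lv _] /hs[lw _] /eqP.
  by rewrite ord_of_eq // => /eqP.
rewrite -(card_uniqP u); apply: subset_leq_card.
apply/fintype.subsetP=> i /mapP[v /hs[_ h] ->].
by rewrite finset.in_set inE.
Qed.

(** The edges from a and b to u_1 and from c to w_1 already make the disks of the outer corners
    reach the origin, which is where [2 <= k] enters. *)
Lemma ply_at_origin : (4 <= ply_at edges drawing (0, 0)%R)%N.
Proof.
have l1 s : (label (Vu s 1) < n)%N by exact: label_Vu.
have l0 s : (label (Vu s 0) < n)%N by apply: label_Vu; lia.
apply: (@ply_at_ge _ [:: Va true; Va false; Vb; Vd]) => // v.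
rewrite !inE => /or4P[]/eqP->; split=> //.
- by apply: (@in_disk (Kua true 1)); [exact: l1 | by right | rewrite /sqdist /= /sg; lra].
- by apply: (@in_disk (Kua false 1)); [exact: l1 | by right | rewrite /sqdist /= /sg; lra].
- by apply: (@in_disk (Kub true 1)); [exact: l1 | by right | rewrite /sqdist /= /sg; lra].
- by apply: (@in_disk (Kuu true 0)); [exact: l0 | by right | rewrite /sqdist /= /sg; lra].
Qed.

(** On the edge from d to u_0 this point is at distance 1/2 from d and 3/2 from u_0, whose radii are
    at least 1 and 2. *)
Lemma ply_at_half : (5 <= ply_at edges drawing (1 / 2, 0)%R)%N.
Proof.
have l1 s : (label (Vu s 1) < n)%N by exact: label_Vu.
have l0 s : (label (Vu s 0) < n)%N by apply: label_Vu; lia.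
apply: (@ply_at_ge _ [:: Va true; Va false; Vb; Vd; Vu true 0]) => // v.
rewrite !inE => /or4P[/eqP->|/eqP->|/eqP->|/orP[]/eqP->]; split=> //.
- by apply: (@in_disk (Kua true 1)); [exact: l1 | by right | rewrite /sqdist /= /sg; lra].
- by apply: (@in_disk (Kua false 1)); [exact: l1 | by right | rewrite /sqdist /= /sg; lra].
- by apply: (@in_disk (Kub true 1)); [exact: l1 | by right | rewrite /sqdist /= /sg; lra].
- by apply: (@in_disk (Kuu true 0)); [exact: l0 | by right | rewrite /sqdist /= /sg; lra].
- by apply: (@in_disk (Kuu true 1)); [exact: l1 | by right | rewrite /sqdist /= /sg; lra].
Qed.

Lemma ply_drawing : ply edges drawing = 5%N.
Proof.
apply/eqP; rewrite eqn_leq; apply/andP; split.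
  apply/bigmax_leqP=> m /asboolP[p <-].
  by apply: leq_trans (ply_at_core p) _; rewrite (leq_add2l 3 _ 2) card_core_at.
apply: leq_trans ply_at_half _.
have h : (ply_at edges drawing (1 / 2, 0)%R < #|'I_n|.+1)%N by rewrite ltnS max_card.
apply: (@leq_bigmax_cond _ _ (fun m : 'I_(#|'I_n|.+1) => m : nat) (Ordinal h)).
by apply/asboolP; exists (1 / 2, 0).
Qed.

Lemma vertex_ply_drawing : vertex_ply edges drawing = 4%N.
Proof.
apply/eqP; rewrite eqn_leq; apply/andP; split.
  apply/bigmax_leqP=> v _.
  by apply: leq_trans (ply_at_core _) _; rewrite (leq_add2l 3 _ 1) card_core_at_vertex.
apply: leq_trans ply_at_origin _.
have <- : drawing (ord_of Vd) = (0, 0) by rewrite /drawing ord_ofK.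
exact: (@leq_bigmax_cond _ _ (fun v => ply_at edges drawing (drawing v))).
Qed.

End Drawing.

(** * The outer triangle is extreme in every direction *)

Section OuterFace.
Variables (R : realType) (V : finType) (E : {set {set V}}) (pos : V -> R * R).
Variables (a b : R).
Hypothesis ab0 : 0 < a ^+ 2 + b ^+ 2.

Let h (p : R * R) : R := a * p.1 + b * p.2.
Let ray (p : R * R) (s : R) : R * R := (p.1 + s * a, p.2 + s * b).

Lemma ray_height p s : h (ray p s) = h p + s * (a ^+ 2 + b ^+ 2).
Proof. by rewrite /h /=; ring. Qed.

Lemma ray_continuous p : continuous (ray p).
Proof.
move=> s.
apply: (@cvg_pair _ _ _ (nbhs s) (nbhs (p.1 + s * a)) (nbhs (p.2 + s * b)) _ _ _
  (fun s => p.1 + s * a) (fun s => p.2 + s * b)).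
  by apply: cvgD; [exact: cvg_cst | apply: cvgM; [exact: cvg_id | exact: cvg_cst]].
by apply: cvgD; [exact: cvg_cst | apply: cvgM; [exact: cvg_id | exact: cvg_cst]].
Qed.

Lemma height_le_norm p : h p <= (`|a| + `|b|) * `|p|.
Proof.
rewrite mulrDl; apply: lerD; apply: le_trans (ler_norm _) _; rewrite normrM;
  by apply: ler_wpM2l => //; rewrite prod_normE le_max lexx ?orbT.
Qed.

Lemma height_segment p q x (m : R) : h p <= m -> h q <= m -> segment p q x -> h x <= m.
Proof.
move=> pm qm [t /andP[t0 t1] ->]; rewrite /h /=.
have := ler_wpM2l t0 qm; have : 0 <= 1 - t by lra.
by move=> /ler_wpM2l/(_ _ _ pm); rewrite /h; lra.
Qed.

(** The ray from [x] in direction [(a, b)] only gains height, so it misses the drawing; being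
    connected and unbounded, it makes the component of [x] unbounded. *)
Lemma above_outer_face (m : R) x : (forall v, h (pos v) <= m) -> m < h x ->
  outer_face E pos x.
Proof.
move=> hm mx.
have free y : m < h y -> (~` drawn_points E pos)%classic y.
  move=> my [[v yv]|[e _ [u [v [_ yuv]]]]].
    by have := hm v; rewrite -yv leNgt my.
  by have := height_segment (hm u) (hm v) yuv; rewrite leNgt my.
split; first exact: free.
have ray_sub : (ray x @` [set s | 0 <= s] `<=`
    connected_component (~` drawn_points E pos) x)%classic.
  apply: connected_component_max.
  - by exists 0; rewrite //= /ray !mul0r !addr0; case: (x).
  - move=> y [s /= s0 <-]; apply: free; rewrite ray_height.
    by have := mulr_ge0 s0 (ltW ab0); lra.
  - apply: connected_continuous_connected; last first.
      by apply: continuous_subspaceT; exact: ray_continuous.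
    apply/connected_intervalP => s t /= s0 t0 z /andP[sz _].
    exact: le_trans s0 sz.
move=> [M0 [_ /(_ (M0 + 1))]]; rewrite ltrDl ltr01 => /(_ isT).
set M := M0 + 1 => bM.
(* Chosen so that the height of [ray x s] exceeds [(|a| + |b|) M], the largest height possible at
   norm at most [M]. *)
pose s := ((`|a| + `|b|) * M + `|h x| + 1) / (a ^+ 2 + b ^+ 2).
have xM : `|x| <= M.
  apply: bM; apply: ray_sub; exists 0 => //=.
  by rewrite /ray !mul0r !addr0; case: (x).
have s0 : 0 <= s.
  apply: divr_ge0; last exact: ltW.
  have := normr_ge0 x; have : 0 <= (`|a| + `|b|) * M; last by have := normr_ge0 (h x); lra.
  by apply: mulr_ge0; [exact: addr_ge0 | exact: le_trans xM].
have yM : `|ray x s| <= M by apply: bM; apply: ray_sub; exists s.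
have := height_le_norm (ray x s); rewrite ray_height divfK ?gt_eqF //.
have := ler_wpM2l (addr_ge0 (normr_ge0 a) (normr_ge0 b)) yM.
by have := ler_norm (- h x); rewrite normrN; lra.
Qed.

(** A highest vertex is a limit of points just above it, which lie in the outer face, and is itself
    drawn; so it is on the boundary, hence on an edge of [t], one of whose ends is at least as
    high. *)
Lemma outer_triangle_height (t : {set V}) : has_outer_triangle E pos t ->
  forall v, exists2 u, u \in t & h (pos v) <= h (pos u).
Proof.
move=> out v.
have [v0 _ vmax] := @arg_maxP _ _ _ v predT (fun i => h (pos i)) isT.
suff [u ut uh] : exists2 u, u \in t & h (pos v0) <= h (pos u).
  by exists u => //; apply: le_trans uh; exact: vmax.
have vm i : h (pos i) <= h (pos v0) by exact: vmax.
have : boundary (outer_face E pos) (pos v0).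
  split.
    move=> B /= nB.
    have {}nB : nbhs (ray (pos v0) 0) B.
      by rewrite /ray !mul0r !addr0 -surjective_pairing.
    have /nbhs_ballP[e /= e0 eB] := @ray_continuous (pos v0) 0 _ nB.
    exists (ray (pos v0) (e / 2)); split.
      apply: (above_outer_face vm); rewrite ray_height ltrDl mulr_gt0 //.
      by rewrite divr_gt0.
    by apply: eB; rewrite /ball /= sub0r normrN gtr0_norm ?divr_gt0 //; lra.
  move=> /interior_subset[nd _]; apply: nd; left; by exists v0.
rewrite out => -[e]; rewrite inE => /andP[/fintype.subsetP et _] [u [w [euw uw]]].
have ut : u \in t by apply: et; rewrite euw !inE eqxx.
have wt : w \in t by apply: et; rewrite euw !inE eqxx orbT.
have [uw_le|/ltW uw_le] := leP (h (pos u)) (h (pos w)).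
  by exists w => //; apply: height_segment uw.
by exists u => //; apply: height_segment uw.
Qed.

End OuterFace.

(** * The linear lower bound by pigeonhole *)

Lemma card_le_fibers (I J : finType) (f : I -> J) (m : nat) :
  (forall j, #|[set i | f i == j]%SET| <= m)%N -> (#|I| <= #|J| * m)%N.
Proof.
move=> fm; rewrite -sum1_card (partition_big f predT) //=.
rewrite -[X in (_ <= X)%N]sum_nat_const; apply: leq_sum => j _.
by rewrite sum1_card -cardsE; exact: fm.
Qed.

Lemma vertex_ply_le_ply (R : realType) (V : finType) (E : {set {set V}})
  (pos : V -> R * R) :
  (vertex_ply E pos <= ply E pos)%N.
Proof.
apply/bigmax_leqP=> v _.
have lt : (ply_at E pos (pos v) < #|V|.+1)%N by rewrite ltnS max_card.
apply: (@leq_bigmax_cond _ _ (fun m : 'I_(#|V|.+1) => m : nat) (Ordinal lt)).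
by apply/asboolP; exists (pos v).
Qed.

Lemma ply_le_card (R : realType) (V : finType) (E : {set {set V}})
  (pos : V -> R * R) :
  (ply E pos <= #|V|)%N.
Proof. by apply/bigmax_leqP=> m _; rewrite -ltnS. Qed.

Lemma ply_radius_ge (R : realType) (V : finType) (E : {set {set V}})
  (pos : V -> R * R) (v u : V) : [set v; u]%SET \in E ->
  Defs.edist (pos v) (pos u) / 2 <= ply_radius E pos v.
Proof.
move=> vu; rewrite ler_pM2r ?invr_gt0 //.
exact: (le_bigmax_cond _ (fun u => Defs.edist (pos v) (pos u))).
Qed.

Section LowerBound.
Variables (R : realType) (k : nat).
Notation n := (k.*2).+4.+1.
Notation ord_of := (ord_of k).
Notation edges := (edges k).
Variable pos : 'I_n -> R * R.
Hypothesis pos_inj : injective pos.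
Hypothesis pos_outer : has_outer_triangle edges pos (outer k).

Let pB := pos (ord_of Vb).
Let pA s := pos (ord_of (Va s)).

Lemma height_bound (a b m : R) : 0 < a ^+ 2 + b ^+ 2 ->
  a * pB.1 + b * pB.2 <= m -> (forall s, a * (pA s).1 + b * (pA s).2 <= m) ->
  forall v, a * (pos v).1 + b * (pos v).2 <= m.
Proof.
move=> ab0 mB mA v; have [u uo uv] := outer_triangle_height ab0 pos_outer v.
apply: le_trans uv _; move: uo; rewrite inE -{2 3}(vert_ofK u).
by case: (vert_of u) => [s _|_|||] //; exact: mA.
Qed.

Lemma long_side : exists2 s, 0 < Defs.edist (pA s) pB &
  forall s', Defs.edist (pA s') pB <= Defs.edist (pA s) pB.
Proof.
have pos_gt0 s : 0 < Defs.edist (pA s) pB.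
  rewrite lt_neqAle sqrtr_ge0 andbT eq_sym sqrtr_eq0 -ltNge lt_neqAle sqdist_ge0 andbT.
  rewrite eq_sym paddr_eq0 ?sqr_ge0 // !sqrf_eq0 !subr_eq0.
  apply/negP=> /andP[/eqP h1 /eqP h2].
  have /pos_inj/eqP : pA s = pB.
    by rewrite (surjective_pairing pB) -h1 -h2 -surjective_pairing.
  by rewrite -(inj_eq (@vert_of_inj k)) !ord_ofK //; case: s {h1 h2}.
have [le|/ltW le] := leP (Defs.edist (pA false) pB) (Defs.edist (pA true) pB).
  by exists true => // -[].
by exists false => // -[].
Qed.

Lemma trunc_eq_dist (x y m : R) : 0 < m -> 0 <= x -> 0 <= y ->
  Num.truncn (x / m) = Num.truncn (y / m) -> (x - y) ^+ 2 < m ^+ 2.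
Proof.
move=> m0 x0 y0 e.
have /andP[x1 x2] := truncn_itv (divr_ge0 x0 (ltW m0)).
have /andP[y1 y2] := truncn_itv (divr_ge0 y0 (ltW m0)).
rewrite e in x1 x2; rewrite -real_normK ?num_real // ltr_sqr ?nnegrE ?(ltW m0) //.
rewrite ler_pdivlMr // in x1; rewrite ler_pdivlMr // in y1.
rewrite ltr_pdivrMr // -natr1 in x2; rewrite ltr_pdivrMr // -natr1 in y2.
by rewrite ltr_norml; apply/andP; split; lra.
Qed.

(** The quotient can equal 16 at the far side of the square, hence 17 cells per side. *)
Lemma trunc_lt17 (x m : R) : 0 < m -> 0 <= x -> x <= 2 * m ->
  (Num.truncn (x / (m / 8)) < 17)%N.
Proof.
move=> m0 x0 xm; rewrite truncn_lt_nat; last by rewrite divr_ge0 // divr_ge0 // ltW.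
by rewrite ltr_pdivrMr ?divr_gt0 //; lra.
Qed.

Lemma card_le_vertex_ply : (k <= 289 * vertex_ply edges pos)%N.
Proof.
have [s M0 Mmax] := long_side; set M := Defs.edist (pA s) pB in M0 Mmax.
have coord s' : [/\ - M <= (pA s').1 - pB.1, (pA s').1 - pB.1 <= M,
    - M <= (pA s').2 - pB.2 & (pA s').2 - pB.2 <= M].
  have := Mmax s'; rewrite (edist_le _ _ (ltW M0)) /sqdist.
  have := sqr_ge0 ((pA s').1 - pB.1); have := sqr_ge0 ((pA s').2 - pB.2) => h2 h1 h.
  have [] : `|(pA s').1 - pB.1| <= M /\ `|(pA s').2 - pB.2| <= M.
    by split; rewrite -ler_sqr ?nnegrE ?(ltW M0) // real_normK ?num_real //; lra.
  by rewrite !ler_norml => /andP[h3 h4] /andP[h5 h6]; split.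
have box v : [/\ 0 <= (pos v).1 - pB.1 + M, (pos v).1 - pB.1 + M <= 2 * M,
    0 <= (pos v).2 - pB.2 + M & (pos v).2 - pB.2 + M <= 2 * M].
  split.
  - suff : -1 * (pos v).1 + 0 * (pos v).2 <= M - pB.1 by lra.
    by apply: height_bound; [lra | lra | move=> s'; case: (coord s') => ? ? ? ?; lra].
  - suff : 1 * (pos v).1 + 0 * (pos v).2 <= M + pB.1 by lra.
    by apply: height_bound; [lra | lra | move=> s'; case: (coord s') => ? ? ? ?; lra].
  - suff : 0 * (pos v).1 + -1 * (pos v).2 <= M - pB.2 by lra.
    by apply: height_bound; [lra | lra | move=> s'; case: (coord s') => ? ? ? ?; lra].
  - suff : 0 * (pos v).1 + 1 * (pos v).2 <= M + pB.2 by lra.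
    by apply: height_bound; [lra | lra | move=> s'; case: (coord s') => ? ? ? ?; lra].
pose c (i : 'I_k) := ord_of (Vu s i).
have c_inj : injective c.
  move=> i j /(congr1 (@vert_of k)); rewrite !ord_ofK ?label_Vu //.
  by case=> /val_inj.
have radius i : M / 4 <= ply_radius edges pos (c i).
  have l e : (ends e).1 = Vu s i -> (label (ends e).1 < n)%N.
    by move->; exact: label_Vu.
  have hA := ply_radius_ge pos (edge_of_edges (l (Kua s i) erefl)).
  have hB := ply_radius_ge pos (edge_of_edges (l (Kub s i) erefl)).
  rewrite leNgt; apply/negP=> lt.
  have {}hA : Defs.edist (pos (c i)) (pA s) < M / 2.
    by move: (le_lt_trans hA lt); rewrite ltr_pdivrMr //; lra.
  have {}hB : Defs.edist (pos (c i)) pB < M / 2.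
    by move: (le_lt_trans hB lt); rewrite ltr_pdivrMr //; lra.
  move: hA hB; rewrite !edist_lt ?divr_ge0 ?(ltW M0) // => hA hB.
  have M2 : M ^+ 2 = sqdist (pA s) pB by rewrite sqr_sqrtr // sqdist_ge0.
  move: hA hB; rewrite expr_div_n M2 /sqdist.
  (* By the parallelogram identity [2 (|p-A|^2 + |p-B|^2) = |A-B|^2 + |2p-A-B|^2], the distances to
     both ends of the long side cannot be below [M / 2]. *)
  have := sqr_ge0 (2 * (pos (c i)).1 - (pA s).1 - pB.1).
  have := sqr_ge0 (2 * (pos (c i)).2 - (pA s).2 - pB.2).
  by lra.
pose cell (i : 'I_k) : 'I_17 * 'I_17 :=
  (inord (Num.truncn (((pos (c i)).1 - pB.1 + M) / (M / 8))),
   inord (Num.truncn (((pos (c i)).2 - pB.2 + M) / (M / 8)))).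
(* Within a cell the squared distance is below [2 (M/8)^2], less than [(M/4)^2]. *)
have near i j : cell i = cell j -> pos (c i) \in ply_disk edges pos (c j).
  have [xi1 xi2 yi1 yi2] := box (c i); have [xj1 xj2 yj1 yj2] := box (c j).
  have m8 : 0 < M / 8 by rewrite divr_gt0.
  case=> /(congr1 val) /=; rewrite !inordK ?trunc_lt17 // => ex.
  move=> /(congr1 val) /=; rewrite !inordK ?trunc_lt17 // => ey.
  have dx := trunc_eq_dist m8 xi1 xj1 ex; have dy := trunc_eq_dist m8 yi1 yj1 ey.
  rewrite inE; apply: lt_le_trans (radius j).
  rewrite edist_lt ?divr_ge0 ?(ltW M0) // /sqdist.
  have := exprn_gt0 2 M0; rewrite expr_div_n.
  by move: dx dy; rewrite !expr_div_n; lra.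
suff : (#|'I_k| <= #|{: 'I_17 * 'I_17}| * vertex_ply edges pos)%N.
  by rewrite card_prod !card_ord.
apply: (@card_le_fibers _ _ cell) => j.
(* Every ply-disk of a nonempty cell contains the vertex of [i0], so the cell has at most as many
   members as the ply there. *)
have [->|[i0]] := set_0Vmem [set i | cell i == j]%SET; first by rewrite cards0.
rewrite inE => /eqP ij.
have lv : (ply_at edges pos (pos (c i0)) <= vertex_ply edges pos)%N.
  exact: (@leq_bigmax_cond _ _ (fun v => ply_at edges pos (pos v)) (c i0)).
apply: leq_trans lv.
rewrite -(card_imset _ c_inj) subset_leq_card //.
apply/fintype.subsetP=> v /imsetP[i]; rewrite inE => /eqP ci ->.
by rewrite finset.in_set near // ij.
Qed.

End LowerBound.

Theorem theorem10 (R : realType) :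
  exists c C : R, 0 < c /\
  forall N : nat, exists n : nat, (N <= n)%N /\
  exists (E : {set {set 'I_n}}) (F : seq {set 'I_n}) (t : {set 'I_n}),
    [/\ planar_3tree [set: 'I_n]%SET E F,
        t \in F,
        (forall pos : 'I_n -> R * R,
           planar_drawing E pos -> has_outer_triangle E pos t ->
           c * n%:R <= (vertex_ply E pos)%:R <= C * n%:R /\
           c * n%:R <= (ply E pos)%:R <= C * n%:R)
      & exists pos : 'I_n -> R * R,
          [/\ straight_line_drawing E pos,
              ply E pos = 5%N,
              vertex_ply E pos = 4%N
            & num_crossings E pos = 3%N]].
Proof.
(* [867 = 3 * 289], where 3 comes from [n = 2k + 5 <= 3k]; this holds as [k >= 5]. The upper
   constant 1 reflects that the ply is at most the number of vertices. *)
exists 867%:R^-1, 1; split; first by rewrite invr_gt0 ltr0n.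
move=> N; pose k := (N + 5)%N; exists (k.*2).+4.+1; split; first by rewrite /k; lia.
have [F [tree out]] := planar_3tree_edges k.
exists (edges k), F, (outer k); split=> //; last first.
  have k2 : (2 <= k)%N by rewrite /k; lia.
  exists (@drawing R k); split.
  - exact: drawing_straight.
  - exact: ply_drawing.
  - exact: vertex_ply_drawing.
  - exact: num_crossings_drawing.
move=> pos [[inj _] _] outer_pos.
have lower := card_le_vertex_ply inj outer_pos.
have vp := vertex_ply_le_ply (edges k) pos.
have := ply_le_card (edges k) pos; rewrite card_ord => pn.
rewrite !mul1r !(mulrC 867%:R^-1) !ler_pdivrMr ?ltr0n // -!natrM !ler_nat.
by split; apply/andP; split; rewrite /k in lower vp pn *; lia.
Qed.
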